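(* For $t\geq0$ let $S_tg(\omega)=g(e^{t}\omega)$ on $B_{\infty,\circ}(\mathbb{U},i)$. The infinitesimal generator $\Gamma$ of $(S_{t})_{t\geq0}$ on $B_{\infty,\circ}(\mathbb{U},i)$ is given by $\Gamma g(\omega)=\omega g'(\omega)$ with domain $$\mathcal{D}(\Gamma)=\{g\in B_{\infty,\circ}(\mathbb{U},i):\omega g'(\omega)\in B_{\infty,\circ}(\mathbb{U},i)\}.$$
   Context: $\mathbb{U}=\{\omega\in\mathbb{C}:\Im(\omega)>0\}$ is the upper half plane and $\mathcal{H}(\mathbb{U})$ is the space of analytic functions on $\mathbb{U}$. The little Bloch space is $B_{\infty,\circ}(\mathbb{U})=\{f\in\mathcal{H}(\mathbb{U}):\lim_{\Im(\omega)\to0}\Im(\omega)|f'(\omega)|=0\}$, with the norm of the Bloch space $B_\infty(\mathbb{U})=\{f\in\mathcal H(\mathbb{U}):\sup_{\omega\in\mathbb{U}}\Im(\omega)|f'(\omega)|<\infty\}$, namely $\|f\|_{B_\infty(\mathbb{U})}=|f(i)|+\sup_{\omega\in\mathbb{U}}\Im(\omega)|f'(\omega)|$. Its subspace $B_{\infty,\circ}(\mathbb{U},i)=\{f\in B_{\infty,\circ}(\mathbb{U}):f(i)=0\}$ is equipped with the norm $\|f\|=\sup_{\omega\in\mathbb{U}}\Im(\omega)|f'(\omega)|$. The infinitesimal generator of a semigroup $(S_t)_{t\ge0}$ is $\Gamma g=\lim_{t\to0^+}\frac{S_tg-g}{t}$ (norm limit), with domain $\mathcal{D}(\Gamma)$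 the set of $g$ for which the limit exists.
   Formalization: The little Bloch condition is imposed also as |ω|→∞, not only as Im ω→0 (otherwise the domain formula fails); since S_t does not preserve g(i)=0, the limit defining Γ is taken in the norm |f(i)|+sup Im(ω)|f'(ω)| and must lie in the subspace f(i)=0. *)

(* Defs.v *)
From Stdlib Require Import Reals.
From Coquelicot Require Import Coquelicot.
Open Scope R_scope.

(* Functions on the upper half plane are represented by total functions
   [C -> C]; only their values on [upper_half_plane] matter, and equality of
   such functions is equality on [upper_half_plane]. *)
Definition upper_half_plane (w : C) : Prop := 0 < Im w.

Definition analytic_on_U (f : C -> C) : Prop :=
  forall w : C, upper_half_plane w ->
    ex_derive (K := C_AbsRing) (V := C_NormedModule) f w.

Definition bloch_weight (f : C -> C) (w : C) : R :=
  Im w * Cmod (C_derive f w).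

(* These are valued in [Rbar]: the value is [p_infty] outside the Bloch space. *)
Definition bloch_seminorm (f : C -> C) : Rbar :=
  Lub_Rbar (fun x : R =>
    exists w : C, upper_half_plane w /\ x = bloch_weight f w).

Definition bloch_norm (f : C -> C) : Rbar :=
  Rbar_plus (Finite (Cmod (f Ci))) (bloch_seminorm f).

(* The limit is taken as w tends to the boundary of the half plane in the
   Riemann sphere, i.e. to the real line or to infinity.  This is the space
   which the Cayley transform identifies with the little Bloch space of the
   disc; its elements automatically have finite Bloch norm.  Without the
   condition at infinity the space would contain [w - i], whose Bloch norm is
   infinite, and dilations would not act on it strongly continuously: consider
   [exp (i w)]. *)
Definition little_bloch (f : C -> C) : Prop :=
  analytic_on_U f /\
  forall eps : posreal, exists delta : posreal,
    forall w : C, upper_half_plane w ->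
      Im w < delta \/ / delta < Cmod w ->
      bloch_weight f w < eps.

Definition little_bloch_i (f : C -> C) : Prop :=
  little_bloch f /\ f Ci = RtoC 0.

Definition dilation (t : R) (g : C -> C) : C -> C :=
  fun w => g (RtoC (exp t) * w)%C.

(* The graph of the generator in [little_bloch_i]: [g] is mapped to [k].
   Dilations do not preserve the condition [f Ci = 0], so the difference
   quotients are only elements of [little_bloch] and the limit is taken in the
   norm of that space.  On [little_bloch_i] this norm is [bloch_seminorm]. *)
Definition generator_graph (S : R -> (C -> C) -> (C -> C)) (g k : C -> C)
  : Prop :=
  little_bloch_i g /\ little_bloch_i k /\
  forall eps : posreal,
    at_right 0 (fun t : R =>
      Rbar_lt (bloch_norm (fun w => (S t g w - g w) / RtoC t - k w)%C) eps).

Definition generator_domain (S : R -> (C -> C) -> (C -> C)) (g : C -> C)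
  : Prop :=
  exists k : C -> C, generator_graph S g k.

(* Main.v *)
Require Import Defs.
From Stdlib Require Import Reals Lra Psatz.
From Coquelicot Require Import Coquelicot.
Open Scope R_scope.

(** Convergence in the Bloch norm implies pointwise convergence, which identifies the
    generator with [w g'].  Conversely, let [G = w g'] be in the little Bloch space and let
    [h] be the error [(S_t g - g) / t - G].  Then [w h'(w)] is the mean over [0 <= s <= t] of
    [e^s w G'(e^s w) - w G'(w)], so the seminorm of [h] is controlled by those of
    [S_s G - G].  These tend to [0] because [Im w G'(w)] is small near the boundary and
    uniformly continuous on compact sets.  The latter needs [G'], hence [g''], to be
    continuous; as [g' = G / w] is continuous, this follows from Cauchy's formula for [g'] as
    a circle integral of [g], which for continuously differentiable [g] is proved by
    differentiating in the radius. *)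

(** * Complex derivatives along real curves *)

(** Multiplication by [d] is the real linear map with the Cauchy-Riemann matrix of [d], and each
    component of the complex remainder is at most its modulus. *)
Lemma is_derive_C_differentiable (f : C -> C) (x y : R) (d : C) :
  is_derive (K := C_AbsRing) (V := C_NormedModule) f (x, y) d ->
  differentiable_pt_lim (fun p q => fst (f (p, q))) x y (fst d) (- snd d) /\
  differentiable_pt_lim (fun p q => snd (f (p, q))) x y (snd d) (fst d).
Proof.
  intros [_ H].
  assert (Hd : forall eps : posreal, locally_2d (fun p q =>
    Cmod (f (p, q) - f (x, y) - ((p, q) - (x, y)) * d)%C
      <= eps * Rmax (Rabs (p - x)) (Rabs (q - y))) x y).
  { intros eps.
    (* The modulus is at most sqrt 2, hence at most 2, times the maximum of the coordinates;
       [eps / 2] absorbs this factor. *)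
    specialize (H (x, y) (fun P HP => HP) (mkposreal (eps / 2) (is_pos_div_2 eps))).
    apply locally_C in H; destruct H as [del H].
    exists del; intros p q Hp Hq.
    specialize (H (p, q) (conj Hp Hq)).
    eapply Rle_trans; [exact H|].
    change (eps / 2 * Cmod ((p, q) - (x, y))%C <= eps * Rmax (Rabs (p - x)) (Rabs (q - y))).
    assert (H2 : Cmod ((p, q) - (x, y))%C <= sqrt 2 * Rmax (Rabs (p - x)) (Rabs (q - y)))
      by exact (Cmod_2Rmax ((p, q) - (x, y))%C).
    assert (Hs : sqrt 2 <= 2)
      by (pose proof (sqrt_pos 2); pose proof (sqrt_sqrt 2 ltac:(lra)); nra).
    pose proof (cond_pos eps).
    pose proof (Rle_trans _ _ _ (Rabs_pos (p - x)) (Rmax_l (Rabs (p - x)) (Rabs (q - y)))).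
    set (m := Rmax _ _) in *.
    assert (sqrt 2 * m <= 2 * m) by (apply Rmult_le_compat_r; assumption).
    replace (eps * m) with (eps / 2 * (2 * m)) by field.
    apply Rmult_le_compat_l; lra. }
  split; intros eps; destruct (Hd eps) as [del H']; exists del; intros p q Hp Hq;
    (eapply Rle_trans; [|exact (H' p q Hp Hq)]);
    eapply Rle_trans; [|apply Rmax_Cmod| |apply Rmax_Cmod].
  - eapply Rle_trans; [|apply Rmax_l]; apply Req_le, f_equal; simpl; ring.
  - eapply Rle_trans; [|apply Rmax_r]; apply Req_le, f_equal; simpl; ring.
Qed.

(** Stated by components, so that the real mean value theorem and the two-variable chain rule apply
    directly. *)
Definition has_velocity (phi : R -> C) (s : R) (d : C) : Prop :=
  is_derive (fun s => fst (phi s)) s (fst d) /\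
  is_derive (fun s => snd (phi s)) s (snd d).

(** By the Cauchy-Riemann form of the differential, the two-variable chain rule assembles into a
    complex product. *)
Lemma has_velocity_comp (f : C -> C) (phi : R -> C) (s : R) (d e : C) :
  is_derive (K := C_AbsRing) (V := C_NormedModule) f (phi s) d ->
  has_velocity phi s e -> has_velocity (fun s => f (phi s)) s (d * e)%C.
Proof.
  intros Hf [H1 H2].
  rewrite (surjective_pairing (phi s)) in Hf.
  apply is_derive_C_differentiable in Hf; destruct Hf as [Hu Hv].
  apply is_derive_Reals in H1; apply is_derive_Reals in H2.
  split; apply is_derive_Reals.
  - pose proof (derivable_pt_lim_comp_2d _ _ _ _ _ _ _ _ Hu H1 H2) as H.
    apply is_derive_Reals in H; apply is_derive_Reals.
    replace (fst (d * e)%C) with (fst d * fst e + - snd d * snd e) by (simpl; ring).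
    eapply is_derive_ext; [|exact H].
    intros t; simpl; now rewrite <- surjective_pairing.
  - pose proof (derivable_pt_lim_comp_2d _ _ _ _ _ _ _ _ Hv H1 H2) as H.
    apply is_derive_Reals in H; apply is_derive_Reals.
    replace (snd (d * e)%C) with (snd d * fst e + fst d * snd e) by (simpl; ring).
    eapply is_derive_ext; [|exact H].
    intros t; simpl; now rewrite <- surjective_pairing.
Qed.

Lemma Cmod_le_Rabs (z : C) : Cmod z <= Rabs (fst z) + Rabs (snd z).
Proof.
  unfold Cmod; rewrite <- (sqrt_Rsqr (Rabs (fst z) + Rabs (snd z)))
    by (pose proof (Rabs_pos (fst z)); pose proof (Rabs_pos (snd z)); lra).
  apply sqrt_le_1_alt; unfold Rsqr.
  rewrite <- (pow2_abs (fst z)), <- (pow2_abs (snd z)).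
  pose proof (Rabs_pos (fst z)); pose proof (Rabs_pos (snd z)); nra.
Qed.

Lemma Rabs_fst_le_Cmod (z : C) : Rabs (fst z) <= Cmod z.
Proof. eapply Rle_trans; [apply Rmax_l | apply Rmax_Cmod]. Qed.

Lemma Rabs_snd_le_Cmod (z : C) : Rabs (snd z) <= Cmod z.
Proof. eapply Rle_trans; [apply Rmax_r | apply Rmax_Cmod]. Qed.

Lemma Rabs_increment_le (f df : R -> R) (a b M : R) :
  a <= b ->
  (forall s, a <= s <= b -> is_derive f s (df s)) ->
  (forall s, a <= s <= b -> Rabs (df s) <= M) ->
  Rabs (f b - f a) <= M * (b - a).
Proof.
  intros Hab Hd HM.
  destruct (MVT_gen f a b df) as [c [Hc ->]].
  - rewrite Rmin_left, Rmax_right by exact Hab; intros s Hs; apply Hd; lra.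
  - rewrite Rmin_left, Rmax_right by exact Hab; intros s Hs.
    apply derivable_continuous_pt; exists (df s); apply is_derive_Reals, Hd, Hs.
  - rewrite Rmin_left, Rmax_right in Hc by exact Hab.
    rewrite Rabs_mult, (Rabs_pos_eq (b - a)) by lra.
    apply Rmult_le_compat_r; [lra | apply HM, Hc].
Qed.

(** The mean value theorem is applied to each component separately, which costs the factor 2. *)
Lemma Cmod_increment_le (phi dphi : R -> C) (a b M : R) :
  a <= b ->
  (forall s, a <= s <= b -> has_velocity phi s (dphi s)) ->
  (forall s, a <= s <= b -> Cmod (dphi s) <= M) ->
  Cmod (phi b - phi a)%C <= 2 * M * (b - a).
Proof.
  intros Hab Hd HM.
  assert (H1 : Rabs (fst (phi b) - fst (phi a)) <= M * (b - a)).
  { apply (Rabs_increment_le (fun s => fst (phi s)) (fun s => fst (dphi s))); auto.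
    - intros s Hs; apply (Hd s Hs).
    - intros s Hs; eapply Rle_trans; [apply Rabs_fst_le_Cmod | apply HM, Hs]. }
  assert (H2 : Rabs (snd (phi b) - snd (phi a)) <= M * (b - a)).
  { apply (Rabs_increment_le (fun s => snd (phi s)) (fun s => snd (dphi s))); auto.
    - intros s Hs; apply (Hd s Hs).
    - intros s Hs; eapply Rle_trans; [apply Rabs_snd_le_Cmod | apply HM, Hs]. }
  eapply Rle_trans; [apply Cmod_le_Rabs|].
  simpl; unfold Rminus in *; lra.
Qed.

Lemma has_velocity_quotient (phi : R -> C) (d : C) (eps : R) :
  has_velocity phi 0 d -> 0 < eps ->
  exists delta : posreal, forall t, 0 < t < delta ->
    Cmod ((phi t - phi 0) / RtoC t - d)%C < eps.
Proof.
  intros [H1 H2] He.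
  apply is_derive_Reals in H1; apply is_derive_Reals in H2.
  destruct (H1 (eps / 2)) as [d1 H1']; [lra|].
  destruct (H2 (eps / 2)) as [d2 H2']; [lra|].
  exists (mkposreal _ (Rmin_stable_in_posreal d1 d2)).
  intros t [Ht0 Ht]; simpl in Ht.
  pose proof (Rmin_l d1 d2); pose proof (Rmin_r d1 d2).
  assert (Hta : Rabs t = t) by (apply Rabs_pos_eq; lra).
  specialize (H1' t ltac:(lra) ltac:(lra)).
  specialize (H2' t ltac:(lra) ltac:(lra)).
  rewrite Rplus_0_l in H1', H2'.
  eapply Rle_lt_trans; [apply Cmod_le_Rabs|].
  replace (fst ((phi t - phi 0) / RtoC t - d)%C) with ((fst (phi t) - fst (phi 0)) / t - fst d)
    by (simpl; field; lra).
  replace (snd ((phi t - phi 0) / RtoC t - d)%C) with ((snd (phi t) - snd (phi 0)) / t - snd d)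
    by (simpl; field; lra).
  lra.
Qed.

(** * Cauchy's formula for the derivative *)

Lemma continuity_2d_pt_comp (f g h : R -> R -> R) (p q : R) :
  continuity_2d_pt f (g p q) (h p q) ->
  continuity_2d_pt g p q -> continuity_2d_pt h p q ->
  continuity_2d_pt (fun p q => f (g p q) (h p q)) p q.
Proof.
  intros Hf Hg Hh eps.
  destruct (Hf eps) as [d Hd].
  destruct (Hg d) as [d1 Hd1]; destruct (Hh d) as [d2 Hd2].
  exists (mkposreal _ (Rmin_stable_in_posreal d1 d2)); simpl; intros s t Hs Ht.
  pose proof (Rmin_l d1 d2); pose proof (Rmin_r d1 d2).
  apply Hd; [apply Hd1 | apply Hd2]; lra.
Qed.

Lemma continuity_2d_pt_continuous_r (f : R -> R -> R) (x y : R) :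
  continuity_2d_pt f x y -> continuous (f x) y.
Proof.
  intros Hf; apply continuity_pt_filterlim, continuity_pt_locally; intros eps.
  destruct (Hf eps) as [d Hd]; exists d; intros t Ht.
  apply Hd; [rewrite Rminus_diag, Rabs_R0; apply cond_pos | exact Ht].
Qed.

Lemma continuity_2d_pt_cos (x t : R) : continuity_2d_pt (fun _ s => cos s) x t.
Proof.
  apply (continuity_1d_2d_pt_comp cos); [apply continuity_cos | apply continuity_2d_pt_id2].
Qed.

Lemma continuity_2d_pt_sin (x t : R) : continuity_2d_pt (fun _ s => sin s) x t.
Proof.
  apply (continuity_1d_2d_pt_comp sin); [apply continuity_sin | apply continuity_2d_pt_id2].
Qed.

(* [u + i v] has complex derivative [a + i b] at [x + i y]. *)
Definition cauchy_riemann (u v : R -> R -> R) (a b x y : R) : Prop :=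
  differentiable_pt_lim u x y a (- b) /\ differentiable_pt_lim v x y b a.

Lemma cauchy_riemann_continuity (u v : R -> R -> R) (a b x y : R) :
  cauchy_riemann u v a b x y -> continuity_2d_pt u x y /\ continuity_2d_pt v x y.
Proof.
  intros [Hu Hv]; split; apply differentiable_continuity_pt;
    [exists a, (- b) | exists b, a]; assumption.
Qed.

Lemma Rabs_mul_cos_lt (r t M : R) : Rabs r < M -> Rabs (r * cos t) < M.
Proof.
  intros H; rewrite Rabs_mult.
  assert (Rabs (cos t) <= 1) by (apply Rabs_le; apply COS_bound).
  pose proof (Rabs_pos r); pose proof (Rabs_pos (cos t)); nra.
Qed.

Lemma Rabs_mul_sin_lt (r t M : R) : Rabs r < M -> Rabs (r * sin t) < M.
Proof.
  intros H; rewrite Rabs_mult.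
  assert (Rabs (sin t) <= 1) by (apply Rabs_le; apply SIN_bound).
  pose proof (Rabs_pos r); pose proof (Rabs_pos (sin t)); nra.
Qed.

Definition on_circle (f : R -> R -> R) (x y r t : R) : R :=
  f (x + r * cos t) (y + r * sin t).

(* The real part of [(u + i v) e^(-i t)] at the point [x + i y + r e^(i t)]. *)
Definition radial (u v : R -> R -> R) (x y r t : R) : R :=
  on_circle u x y r t * cos t + on_circle v x y r t * sin t.

Lemma continuity_2d_pt_on_circle (f : R -> R -> R) (x y r t : R) :
  continuity_2d_pt f (x + r * cos t) (y + r * sin t) ->
  continuity_2d_pt (on_circle f x y) r t.
Proof.
  intros Hf.
  apply (continuity_2d_pt_comp f (fun r t => x + r * cos t) (fun r t => y + r * sin t));
    [exact Hf | |]; apply continuity_2d_pt_plus;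
    try apply continuity_2d_pt_const; apply continuity_2d_pt_mult;
    auto using continuity_2d_pt_id1, continuity_2d_pt_cos, continuity_2d_pt_sin.
Qed.

Lemma continuity_2d_pt_radial (u v : R -> R -> R) (x y r t : R) :
  continuity_2d_pt u (x + r * cos t) (y + r * sin t) ->
  continuity_2d_pt v (x + r * cos t) (y + r * sin t) ->
  continuity_2d_pt (radial u v x y) r t.
Proof.
  intros Hu Hv.
  apply continuity_2d_pt_plus; apply continuity_2d_pt_mult;
    auto using continuity_2d_pt_on_circle, continuity_2d_pt_cos, continuity_2d_pt_sin.
Qed.

(** Differentiating in the radius brings out a factor e^(i t), which cancels e^(-i t) and leaves the
    real part of the complex derivative. *)
Lemma is_derive_radial_radius (u v : R -> R -> R) (a b x y r t : R) :
  cauchy_riemann u v a b (x + r * cos t) (y + r * sin t) ->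
  is_derive (fun r => radial u v x y r t) r a.
Proof.
  intros [Hu Hv].
  assert (Hc : derivable_pt_lim (fun r => x + r * cos t) r (cos t))
    by (apply is_derive_Reals; auto_derive; [trivial | ring]).
  assert (Hs : derivable_pt_lim (fun r => y + r * sin t) r (sin t))
    by (apply is_derive_Reals; auto_derive; [trivial | ring]).
  pose proof (derivable_pt_lim_comp_2d _ _ _ _ _ _ _ _ Hu Hc Hs) as H1.
  pose proof (derivable_pt_lim_comp_2d _ _ _ _ _ _ _ _ Hv Hc Hs) as H2.
  apply is_derive_Reals in H1; apply is_derive_Reals in H2.
  replace a with ((a * cos t + - b * sin t) * cos t + (b * cos t + a * sin t) * sin t)
    by (pose proof (sin2_cos2 t) as E; unfold Rsqr in E;
        transitivity (a * (sin t * sin t + cos t * cos t)); [ring | rewrite E; ring]).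
  apply (is_derive_plus (K := R_AbsRing) (V := R_NormedModule)); apply (is_derive_scal_l (K := R_AbsRing) (V := R_NormedModule));
    assumption.
Qed.

(* The conjugate [Re (i (u + i v) e^(-i t))] is a primitive of [radial - r a]. *)
Lemma is_derive_radial_angle (u v : R -> R -> R) (a b x y r t : R) :
  cauchy_riemann u v a b (x + r * cos t) (y + r * sin t) ->
  is_derive (fun t => on_circle u x y r t * sin t - on_circle v x y r t * cos t) t
    (radial u v x y r t - r * a).
Proof.
  intros [Hu Hv].
  assert (Hc : derivable_pt_lim (fun t => x + r * cos t) t (- r * sin t))
    by (apply is_derive_Reals; auto_derive; [trivial | ring]).
  assert (Hs : derivable_pt_lim (fun t => y + r * sin t) t (r * cos t))
    by (apply is_derive_Reals; auto_derive; [trivial | ring]).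
  pose proof (derivable_pt_lim_comp_2d _ _ _ _ _ _ _ _ Hu Hc Hs) as H1.
  pose proof (derivable_pt_lim_comp_2d _ _ _ _ _ _ _ _ Hv Hc Hs) as H2.
  apply is_derive_Reals.
  pose proof (derivable_pt_lim_minus _ _ _ _ _
    (derivable_pt_lim_mult _ _ _ _ _ H1 (derivable_pt_lim_sin t))
    (derivable_pt_lim_mult _ _ _ _ _ H2 (derivable_pt_lim_cos t))) as H.
  replace (radial u v x y r t - r * a) with
    ((a * (- r * sin t) + - b * (r * cos t)) * sin t + on_circle u x y r t * cos t -
     ((b * (- r * sin t) + a * (r * cos t)) * cos t + on_circle v x y r t * (- sin t))); [exact H|].
  pose proof (sin2_cos2 t) as E; unfold Rsqr in E; unfold radial.
  replace (r * a) with (r * a * (sin t * sin t + cos t * cos t)) by (rewrite E; ring).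
  ring.
Qed.

Lemma ex_RInt_radial_continuous (f g : R -> R -> R) (x y r : R) :
  (forall t, continuity_2d_pt f (x + r * cos t) (y + r * sin t)) ->
  (forall t, continuity_2d_pt g (x + r * cos t) (y + r * sin t)) ->
  ex_RInt (radial f g x y r) 0 (2 * PI).
Proof.
  intros Hf Hg; apply (ex_RInt_continuous (V := R_CompleteNormedModule)); intros t _.
  now apply continuity_2d_pt_continuous_r, continuity_2d_pt_radial.
Qed.

Lemma locally_Rabs_lt (r M : R) : Rabs r < M -> locally r (fun s => Rabs s < M).
Proof.
  intros Hr.
  exists (mkposreal (M - Rabs r) ltac:(lra)); intros s Hs.
  change (Rabs (s - r) < M - Rabs r) in Hs.
  replace s with (s - r + r) by ring; pose proof (Rabs_triang (s - r) r); lra.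
Qed.

Section Circle.

Variables (u v a b : R -> R -> R) (x y M : R).
Hypothesis HM : 0 < M.
Hypothesis Hcr : forall p q, Rabs (p - x) < M -> Rabs (q - y) < M ->
  cauchy_riemann u v (a p q) (b p q) p q /\
  continuity_2d_pt a p q /\ continuity_2d_pt b p q.

Lemma circle_cauchy_riemann (r t : R) : Rabs r < M ->
  cauchy_riemann u v (on_circle a x y r t) (on_circle b x y r t)
    (x + r * cos t) (y + r * sin t) /\
  continuity_2d_pt a (x + r * cos t) (y + r * sin t) /\
  continuity_2d_pt b (x + r * cos t) (y + r * sin t).
Proof.
  intros Hr; apply Hcr.
  - replace (x + r * cos t - x) with (r * cos t) by ring; now apply Rabs_mul_cos_lt.
  - replace (y + r * sin t - y) with (r * sin t) by ring; now apply Rabs_mul_sin_lt.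
Qed.

Lemma ex_RInt_radial (r : R) : Rabs r < M -> ex_RInt (radial u v x y r) 0 (2 * PI).
Proof.
  intros Hr; apply ex_RInt_radial_continuous; intros t;
    eapply (cauchy_riemann_continuity u v), circle_cauchy_riemann, Hr.
Qed.

Lemma ex_RInt_circle (r : R) : Rabs r < M -> ex_RInt (on_circle a x y r) 0 (2 * PI).
Proof.
  intros Hr; apply (ex_RInt_continuous (V := R_CompleteNormedModule)); intros t _.
  destruct (circle_cauchy_riemann r t Hr) as [_ [H _]].
  now apply continuity_2d_pt_continuous_r, continuity_2d_pt_on_circle.
Qed.

(** Differentiation under the integral sign is justified by the joint continuity of [a] along the
    circle. *)
Lemma is_derive_RInt_radial (r : R) : Rabs r < M ->
  is_derive (fun r => RInt (radial u v x y r) 0 (2 * PI)) r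
    (RInt (on_circle a x y r) 0 (2 * PI)).
Proof.
  intros Hr.
  assert (Hd : forall s t, Rabs s < M ->
    is_derive (fun s => radial u v x y s t) s (on_circle a x y s t)).
  { intros s t Hs; destruct (circle_cauchy_riemann s t Hs) as [H _].
    exact (is_derive_radial_radius _ _ _ _ _ _ _ _ H). }
  rewrite <- (RInt_ext (fun t => Derive (fun s => radial u v x y s t) r))
    by (intros t _; now apply is_derive_unique, Hd).
  apply (is_derive_RInt_param (fun r t => radial u v x y r t)).
  - apply (filter_imp (fun s => Rabs s < M)); [|now apply locally_Rabs_lt].
    intros s Hs t _; exists (on_circle a x y s t); now apply Hd.
  - intros t _.
    destruct (circle_cauchy_riemann r t Hr) as [_ [H _]].
    apply continuity_2d_pt_ext_loc with (on_circle a x y);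
      [|now apply continuity_2d_pt_on_circle].
    destruct (locally_Rabs_lt r M Hr) as [d Hdl]; exists d; intros s w Hs _.
    symmetry; now apply is_derive_unique, Hd, Hdl.
  - apply (filter_imp (fun s => Rabs s < M)); [|now apply locally_Rabs_lt].
    exact ex_RInt_radial.
Qed.

(** The difference of the integrands has a primitive in the angle that takes the same value at 0 and
    at 2 pi. *)
Lemma RInt_radial_eq (r : R) : Rabs r < M ->
  RInt (radial u v x y r) 0 (2 * PI) = r * RInt (on_circle a x y r) 0 (2 * PI).
Proof.
  intros Hr.
  assert (H : is_RInt (fun t => radial u v x y r t - r * on_circle a x y r t) 0 (2 * PI) 0).
  { set (w := fun t => on_circle u x y r t * sin t - on_circle v x y r t * cos t).
    replace 0 with (minus (w (2 * PI)) (w 0)) at 2.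
    - apply (is_RInt_derive (V := R_CompleteNormedModule)).
      + intros t _; destruct (circle_cauchy_riemann r t Hr) as [H _].
        exact (is_derive_radial_angle _ _ _ _ _ _ _ _ H).
      + intros t _; destruct (circle_cauchy_riemann r t Hr) as [H [Ha _]].
        apply cauchy_riemann_continuity in H.
        apply (continuity_2d_pt_continuous_r
          (fun r t => radial u v x y r t - r * on_circle a x y r t)).
        apply continuity_2d_pt_minus; [apply continuity_2d_pt_radial; apply H|].
        apply continuity_2d_pt_mult; [apply continuity_2d_pt_id1|].
        now apply continuity_2d_pt_on_circle.
    - unfold w, minus, plus, opp, on_circle; simpl.
      rewrite cos_2PI, sin_2PI, cos_0, sin_0; ring. }
  apply (is_RInt_unique (V := R_CompleteNormedModule)) in H.
  rewrite (RInt_minus (V := R_CompleteNormedModule)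
    (radial u v x y r) (fun t => r * on_circle a x y r t)) in H.
  - rewrite (RInt_scal (V := R_CompleteNormedModule) (on_circle a x y r)) in H
      by now apply ex_RInt_circle.
    unfold minus, plus, opp, scal in H; simpl in H; unfold mult in H; simpl in H; lra.
  - now apply ex_RInt_radial.
  - apply (ex_RInt_scal (V := R_CompleteNormedModule)); now apply ex_RInt_circle.
Qed.

(* With [P r] the integral, [P' = P / r], so that [P r / r] is constant, equal to its
   limit [P' 0] at the center. *)
Lemma cauchy_formula_derivative (r : R) : 0 < r < M ->
  RInt (radial u v x y r) 0 (2 * PI) = 2 * PI * r * a x y.
Proof.
  intros Hr.
  set (P := (fun r => RInt (radial u v x y r) 0 (2 * PI)) : R -> R).
  assert (HP0 : P 0 = 0).
  { unfold P; rewrite RInt_radial_eq by (rewrite Rabs_R0; exact HM); apply Rmult_0_l. }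
  assert (HP' : is_derive P 0 (2 * PI * a x y)).
  { replace (2 * PI * a x y) with (RInt (on_circle a x y 0) 0 (2 * PI));
      [apply is_derive_RInt_radial; rewrite Rabs_R0; exact HM|].
    rewrite (RInt_ext _ (fun _ => a x y)).
    - rewrite RInt_const; change ((2 * PI - 0) * a x y = 2 * PI * a x y); ring.
    - intros t _; unfold on_circle; now rewrite !Rmult_0_l, !Rplus_0_r. }
  assert (Hc : forall s, 0 < s <= r -> P s / s = P r / r).
  { intros s Hs.
    (* The derivative of P z / z vanishes by [RInt_radial_eq], so the increment bound holds with
       constant 0. *)
    enough (E : Rabs (P r / r - P s / s) <= 0 * (r - s)).
    { rewrite Rmult_0_l in E.
      assert (E0 : P r / r - P s / s = 0); [|lra].
      destruct (Req_dec (P r / r - P s / s) 0) as [|N]; [assumption|].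
      apply Rabs_pos_lt in N; lra. }
    apply (Rabs_increment_le (fun s => P s / s) (fun _ => 0)); [lra | |].
    - intros z Hz.
      assert (HzM : Rabs z < M) by (rewrite Rabs_pos_eq; lra).
      replace 0 with ((RInt (on_circle a x y z) 0 (2 * PI) * z - P z * 1) / z ^ 2).
      + apply is_derive_div; [now apply is_derive_RInt_radial | apply (is_derive_id (K := R_AbsRing)) | lra].
      + unfold P; rewrite RInt_radial_eq by exact HzM; field; lra.
    - intros z Hz; rewrite Rabs_R0; lra. }
  enough (E : P r / r = 2 * PI * a x y).
  { assert (Er : P r = P r / r * r) by (field; lra).
    rewrite E in Er; transitivity (2 * PI * a x y * r); [exact Er|]; simpl; ring. }
  destruct (Req_dec (P r / r) (2 * PI * a x y)) as [|N]; [assumption|exfalso].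
  apply is_derive_Reals in HP'.
  (* The gap itself serves as the tolerance in the derivative of [P] at 0. At s = min (d / 2) r, the
     quotient P s / s is closer to P' 0 than the gap, yet it equals P r / r. *)
  assert (Hpos : 0 < Rabs (P r / r - 2 * PI * a x y)) by (apply Rabs_pos_lt; lra).
  destruct (HP' _ Hpos) as [d Hd].
  pose proof (cond_pos d); pose proof (Rmin_l (d / 2) r); pose proof (Rmin_r (d / 2) r).
  assert (Hs : 0 < Rmin (d / 2) r) by (apply Rmin_glb_lt; lra).
  specialize (Hd (Rmin (d / 2) r) ltac:(lra)).
  rewrite Rabs_pos_eq in Hd by lra; specialize (Hd ltac:(lra)).
  rewrite Rplus_0_l, HP0, Rminus_0_r, Hc in Hd by lra; lra.
Qed.

End Circle.

(** * Continuity of the second derivative *)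

Lemma on_circle_bound (r t p x : R) : 0 <= r -> Rabs (p - x) <= r ->
  (x - 2 * r <= p + r * cos t <= x + 2 * r) /\ (x - 2 * r <= p + r * sin t <= x + 2 * r).
Proof.
  intros Hr Hp; apply Rabs_le_between in Hp.
  pose proof (COS_bound t); pose proof (SIN_bound t).
  split; split; nra.
Qed.

(** Circles of radius [r] whose center is within [r] of (x, y) in each coordinate stay in a closed
    square of half-side 2 r, on which [f] and [g] are uniformly continuous. *)
Lemma continuity_2d_pt_RInt_radial (f g : R -> R -> R) (x y r : R) : 0 < r ->
  (forall p q, x - 2 * r <= p <= x + 2 * r -> y - 2 * r <= q <= y + 2 * r ->
    continuity_2d_pt f p q /\ continuity_2d_pt g p q) ->
  continuity_2d_pt (fun p q => RInt (radial f g p q r) 0 (2 * PI)) x y.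
Proof.
  intros Hr Hc eps.
  pose proof PI_RGT_0 as Hpi; pose proof (cond_pos eps) as Heps.
  (* Two terms of this size, integrated over a length 2 pi, contribute at most [eps / 2]. *)
  assert (He : 0 < eps / (8 * PI)) by (apply Rdiv_lt_0_compat; lra).
  destruct (uniform_continuity_2d f (x - 2 * r) (x + 2 * r) (y - 2 * r) (y + 2 * r)
    (fun p q Hp Hq => proj1 (Hc p q Hp Hq)) (mkposreal _ He)) as [d1 Hd1].
  destruct (uniform_continuity_2d g (x - 2 * r) (x + 2 * r) (y - 2 * r) (y + 2 * r)
    (fun p q Hp Hq => proj2 (Hc p q Hp Hq)) (mkposreal _ He)) as [d2 Hd2].
  simpl in Hd1, Hd2.
  pose proof (cond_pos d1); pose proof (cond_pos d2).
  assert (Hd : 0 < Rmin r (Rmin d1 d2)) by (repeat apply Rmin_glb_lt; lra).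
  exists (mkposreal _ Hd); simpl; intros p q Hp Hq.
  pose proof (Rmin_l r (Rmin d1 d2)); pose proof (Rmin_r r (Rmin d1 d2)).
  pose proof (Rmin_l d1 d2); pose proof (Rmin_r d1 d2).
  assert (Hin : forall s z, Rabs (s - x) <= r -> Rabs (z - y) <= r ->
    ex_RInt (radial f g s z r) 0 (2 * PI)).
  { intros s z Hs Hz; apply ex_RInt_radial_continuous; intros t;
      apply Hc; now apply on_circle_bound; try lra. }
  assert (Hz0 : forall z, Rabs (z - z) <= r) by (intros z; rewrite Rminus_diag, Rabs_R0; lra).
  assert (Hpq := Hin p q ltac:(lra) ltac:(lra)).
  assert (Hxy := Hin x y (Hz0 x) (Hz0 y)).
  change (Rabs (minus (RInt (radial f g p q r) 0 (2 * PI)) (RInt (radial f g x y r) 0 (2 * PI))) < eps).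
  rewrite <- (RInt_minus (V := R_CompleteNormedModule)) by assumption.
  eapply Rle_lt_trans; [apply (abs_RInt_le_const _ 0 (2 * PI) (2 * (eps / (8 * PI))))|].
  - lra.
  - now apply (ex_RInt_minus (V := R_CompleteNormedModule)).
  - intros t _.
    destruct (on_circle_bound r t p x ltac:(lra) ltac:(lra)) as [Hp1 _].
    destruct (on_circle_bound r t x x ltac:(lra) (Hz0 x)) as [Hp2 _].
    destruct (on_circle_bound r t q y ltac:(lra) ltac:(lra)) as [_ Hq1].
    destruct (on_circle_bound r t y y ltac:(lra) (Hz0 y)) as [_ Hq2].
    assert (Ep : Rabs (p + r * cos t - (x + r * cos t)) = Rabs (p - x)) by (f_equal; ring).
    assert (Eq : Rabs (q + r * sin t - (y + r * sin t)) = Rabs (q - y)) by (f_equal; ring).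
    assert (Df : Rabs (on_circle f p q r t - on_circle f x y r t) < eps / (8 * PI))
      by (apply Hd1; try assumption; rewrite ?Ep, ?Eq; lra).
    assert (Dg : Rabs (on_circle g p q r t - on_circle g x y r t) < eps / (8 * PI))
      by (apply Hd2; try assumption; rewrite ?Ep, ?Eq; lra).
    change (Rabs (radial f g p q r t - radial f g x y r t) <= 2 * (eps / (8 * PI))).
    replace (radial f g p q r t - radial f g x y r t) with
      ((on_circle f p q r t - on_circle f x y r t) * cos t +
       (on_circle g p q r t - on_circle g x y r t) * sin t) by (unfold radial; ring).
    eapply Rle_trans; [apply Rabs_triang|].
    pose proof (Rabs_mul_cos_lt _ t _ Df); pose proof (Rabs_mul_sin_lt _ t _ Dg); lra.
  - replace ((2 * PI - 0) * (2 * (eps / (8 * PI)))) with (eps / 2) by (field; lra); lra.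
Qed.

(** A horizontal shift of the center leaves e^(-i t) fixed and replaces u + i v by its complex
    derivative a + i b, so the result is the real part of (a + i b) e^(-i t). *)
Lemma is_derive_radial_abscissa (u v : R -> R -> R) (a b x y r t : R) :
  cauchy_riemann u v a b (x + r * cos t) (y + r * sin t) ->
  is_derive (fun x => radial u v x y r t) x (a * cos t + b * sin t).
Proof.
  intros [Hu Hv].
  assert (Hc : derivable_pt_lim (fun x => x + r * cos t) x 1)
    by (apply is_derive_Reals; auto_derive; [trivial | ring]).
  assert (Hs : derivable_pt_lim (fun x => y + r * sin t) x 0)
    by (apply is_derive_Reals; auto_derive; [trivial | ring]).
  pose proof (derivable_pt_lim_comp_2d _ _ _ _ _ _ _ _ Hu Hc Hs) as H1.
  pose proof (derivable_pt_lim_comp_2d _ _ _ _ _ _ _ _ Hv Hc Hs) as H2.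
  apply is_derive_Reals in H1; apply is_derive_Reals in H2.
  replace a with (a * 1 + - b * 0) by ring.
  replace b with (b * 1 + a * 0) at 2 by ring.
  apply (is_derive_plus (K := R_AbsRing) (V := R_NormedModule));
    apply (is_derive_scal_l (K := R_AbsRing) (V := R_NormedModule)); assumption.
Qed.

Section HalfPlane.

Variables u v a b : R -> R -> R.
Hypothesis Hcr : forall p q, 0 < q ->
  cauchy_riemann u v (a p q) (b p q) p q /\
  continuity_2d_pt a p q /\ continuity_2d_pt b p q.

Lemma on_circle_pos (r q t : R) : 0 < r < q -> 0 < q + r * sin t.
Proof. pose proof (SIN_bound t); nra. Qed.

Lemma is_derive_RInt_radial_abscissa (x y r : R) : 0 < r < y ->
  is_derive (fun x => RInt (radial u v x y r) 0 (2 * PI)) x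
    (RInt (radial a b x y r) 0 (2 * PI)).
Proof.
  intros Hr.
  assert (Hd : forall p t, is_derive (fun p => radial u v p y r t) p (radial a b p y r t)).
  { intros p t; apply is_derive_radial_abscissa, Hcr, on_circle_pos, Hr. }
  rewrite <- (RInt_ext (fun t => Derive (fun p => radial u v p y r t) x))
    by (intros t _; apply is_derive_unique, Hd).
  apply (is_derive_RInt_param (fun p t => radial u v p y r t)).
  - apply filter_forall; intros p t _; exists (radial a b p y r t); apply Hd.
  - intros t _.
    apply continuity_2d_pt_ext with (fun p s => radial a b p y r s);
      [intros; symmetry; apply is_derive_unique, Hd|].
    destruct (Hcr (x + r * cos t) _ (on_circle_pos r y t Hr)) as [_ [Ha Hb]].
    apply continuity_2d_pt_plus; apply continuity_2d_pt_mult;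
      try apply continuity_2d_pt_cos; try apply continuity_2d_pt_sin.
    + apply (continuity_2d_pt_comp a (fun p s => p + r * cos s) (fun p s => y + r * sin s));
        [exact Ha | |]; apply continuity_2d_pt_plus; try apply continuity_2d_pt_mult;
        auto using continuity_2d_pt_id1, continuity_2d_pt_const, continuity_2d_pt_cos,
          continuity_2d_pt_sin.
    + apply (continuity_2d_pt_comp b (fun p s => p + r * cos s) (fun p s => y + r * sin s));
        [exact Hb | |]; apply continuity_2d_pt_plus; try apply continuity_2d_pt_mult;
        auto using continuity_2d_pt_id1, continuity_2d_pt_const, continuity_2d_pt_cos,
          continuity_2d_pt_sin.
  - apply filter_forall; intros p; apply ex_RInt_radial_continuous; intros t;
      eapply (cauchy_riemann_continuity u v), Hcr, on_circle_pos, Hr.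
Qed.

(** Cauchy's formula writes [a] as a circle integral of u + i v. Moving the center then
    differentiates u + i v, whose derivative is known to be continuous, instead of [a] itself. *)
Lemma is_derive_cauchy_formula (x y r : R) : 0 < r < y ->
  is_derive (fun x => a x y) x (RInt (radial a b x y r) 0 (2 * PI) / (2 * PI * r)).
Proof.
  intros Hr; pose proof PI_RGT_0.
  apply is_derive_ext with (fun x => RInt (radial u v x y r) 0 (2 * PI) * / (2 * PI * r)).
  (* The formula is used with M = y: the open square of half-side y about (p, y) lies in the half
     plane. *)
  - intros p; rewrite (cauchy_formula_derivative u v a b p y y);
      [change (2 * PI * r * a p y * / (2 * PI * r) = a p y); field; lra | lra | | exact Hr].
    intros s z _ Hz; apply Hcr; apply Rabs_lt_between in Hz; lra.
  - apply (is_derive_scal_l (K := R_AbsRing) (V := R_NormedModule)).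
    now apply is_derive_RInt_radial_abscissa.
Qed.

(** The partial derivative in the abscissa alone gives the real part of the second complex
    derivative. Near each point it is a circle integral of fixed radius, continuous in the
    center. *)
Lemma continuous_second_derivative :
  exists A : R -> R -> R, forall p q, 0 < q ->
    is_derive (fun p => a p q) p (A p q) /\ continuity_2d_pt A p q.
Proof.
  exists (fun p q => Derive (fun p => a p q) p); intros x y Hy; split.
  - apply Derive_correct; eexists; apply (is_derive_cauchy_formula x y (y / 2)); lra.
  - apply continuity_2d_pt_ext_loc with
      (fun p q => RInt (radial a b p q (y / 4)) 0 (2 * PI) * / (2 * PI * (y / 4))).
    + exists (mkposreal (y / 2) ltac:(lra)); simpl; intros p q _ Hq.
      apply Rabs_lt_between in Hq.
      symmetry; apply is_derive_unique, is_derive_cauchy_formula; lra.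
    + apply continuity_2d_pt_mult; [|apply continuity_2d_pt_const].
      apply continuity_2d_pt_RInt_radial; [lra|].
      intros p q _ Hq; apply Hcr; lra.
Qed.

End HalfPlane.

(** * Derivatives on the half plane *)

Lemma locally_upper_half_plane (w : C) : upper_half_plane w ->
  locally (T := AbsRing_UniformSpace C_AbsRing) w upper_half_plane.
Proof.
  intros Hw; apply locally_C.
  exists (mkposreal _ Hw); intros z [_ Hz].
  change (Rabs (Im z - Im w) < Im w) in Hz.
  apply Rabs_lt_between in Hz; unfold upper_half_plane; lra.
Qed.

Lemma is_derive_C_derive (f : C -> C) (w : C) :
  analytic_on_U f -> upper_half_plane w ->
  is_derive (K := C_AbsRing) (V := C_NormedModule) f w (C_derive f w).
Proof. intros Hf Hw; now apply C_derive_correct, Hf. Qed.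

Lemma is_derive_ext_on_U (f g : C -> C) (w d : C) :
  (forall z, upper_half_plane z -> f z = g z) -> upper_half_plane w ->
  is_derive (K := C_AbsRing) (V := C_NormedModule) f w d ->
  is_derive (K := C_AbsRing) (V := C_NormedModule) g w d.
Proof.
  intros He Hw; apply is_derive_ext_loc.
  now apply (filter_imp upper_half_plane), locally_upper_half_plane.
Qed.

Lemma Im_Ci_pos : upper_half_plane Ci.
Proof. unfold upper_half_plane; simpl; lra. Qed.

(** The half plane is open, so derivatives depend only on the values there. This transfers
    membership from a limit [k] to w g', which agrees with [k] only on the half plane. *)
Lemma little_bloch_i_ext (f g : C -> C) :
  (forall z, upper_half_plane z -> f z = g z) -> little_bloch_i f -> little_bloch_i g.
Proof.
  intros He [[Ha Hl] Hi].
  assert (Hd : forall w, upper_half_plane w ->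
    is_derive (K := C_AbsRing) (V := C_NormedModule) g w (C_derive f w)).
  { intros w Hw; apply (is_derive_ext_on_U f); auto using is_derive_C_derive. }
  split; [split|].
  - intros w Hw; exists (C_derive f w); auto.
  - intros eps; destruct (Hl eps) as [delta Hdelta]; exists delta; intros w Hw Hb.
    unfold bloch_weight; rewrite (is_C_derive_unique _ _ _ (Hd w Hw)); now apply Hdelta.
  - rewrite <- He; [exact Hi | exact Im_Ci_pos].
Qed.

Lemma analytic_cauchy_riemann (f : C -> C) (p q : R) :
  analytic_on_U f -> 0 < q ->
  cauchy_riemann (fun p q => fst (f (p, q))) (fun p q => snd (f (p, q)))
    (fst (C_derive f (p, q))) (snd (C_derive f (p, q))) p q.
Proof. intros Hf Hq; apply is_derive_C_differentiable; now apply is_derive_C_derive. Qed.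

(** The function G = w g' is analytic, hence continuous, and g' = G / w with w nonzero on the half
    plane. *)
Lemma continuity_2d_pt_derivative (g : C -> C) (p q : R) :
  analytic_on_U g -> analytic_on_U (fun w => w * C_derive g w)%C -> 0 < q ->
  continuity_2d_pt (fun p q => fst (C_derive g (p, q))) p q /\
  continuity_2d_pt (fun p q => snd (C_derive g (p, q))) p q.
Proof.
  intros Hg HG Hq.
  destruct (cauchy_riemann_continuity _ _ _ _ _ _ (analytic_cauchy_riemann _ p q HG Hq))
    as [H1 H2].
  assert (Hn : continuity_2d_pt (fun p q => / (p * p + q * q)) p q).
  { apply (continuity_2d_pt_inv (fun p q => p * p + q * q)); [|nra].
    apply continuity_2d_pt_plus; apply continuity_2d_pt_mult;
      auto using continuity_2d_pt_id1, continuity_2d_pt_id2. }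
  split.
  (* This is the real part of conj(w) G / |w|^2; the imaginary part is treated likewise below. *)
  - apply continuity_2d_pt_ext_loc with (fun p q =>
      (p * fst ((p, q) * C_derive g (p, q))%C + q * snd ((p, q) * C_derive g (p, q))%C)
      * / (p * p + q * q)).
    + exists (mkposreal _ Hq); simpl; intros s t _ Ht; apply Rabs_lt_between in Ht.
      field; nra.
    + apply continuity_2d_pt_mult; [|exact Hn].
      apply continuity_2d_pt_plus; apply continuity_2d_pt_mult;
        auto using continuity_2d_pt_id1, continuity_2d_pt_id2.
  - apply continuity_2d_pt_ext_loc with (fun p q =>
      (p * snd ((p, q) * C_derive g (p, q))%C - q * fst ((p, q) * C_derive g (p, q))%C)
      * / (p * p + q * q)).
    + exists (mkposreal _ Hq); simpl; intros s t _ Ht; apply Rabs_lt_between in Ht.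
      field; nra.
    + apply continuity_2d_pt_mult; [|exact Hn].
      apply continuity_2d_pt_minus; apply continuity_2d_pt_mult;
        auto using continuity_2d_pt_id1, continuity_2d_pt_id2.
Qed.

(** The derivative of w g' is g' + w g'', and both g' and g'' are continuous. *)
Lemma continuity_2d_pt_second_derivative (g : C -> C) (p q : R) :
  analytic_on_U g -> analytic_on_U (fun w => w * C_derive g w)%C -> 0 < q ->
  continuity_2d_pt (fun p q => fst (C_derive (fun w => w * C_derive g w)%C (p, q))) p q /\
  continuity_2d_pt (fun p q => snd (C_derive (fun w => w * C_derive g w)%C (p, q))) p q.
Proof.
  intros Hg HG Hq.
  set (u := fun p q => fst (g (p, q))).
  set (v := fun p q => snd (g (p, q))).
  set (a := fun p q => fst (C_derive g (p, q))).
  set (b := fun p q => snd (C_derive g (p, q))).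
  assert (Hcr : forall p q, 0 < q -> cauchy_riemann u v (a p q) (b p q) p q /\
    continuity_2d_pt a p q /\ continuity_2d_pt b p q).
  { intros s t Ht; split; [now apply analytic_cauchy_riemann|].
    now apply continuity_2d_pt_derivative. }
  (* This is the Cauchy-Riemann data of -i g, with derivative b - i a. Applying
     [continuous_second_derivative] to g and to -i g yields the real part [A] and the imaginary part
     [B] of g''. *)
  assert (Hcr' : forall p q, 0 < q ->
    cauchy_riemann v (fun p q => - u p q) (b p q) (- a p q) p q /\
    continuity_2d_pt b p q /\ continuity_2d_pt (fun p q => - a p q) p q).
  { intros s t Ht; destruct (Hcr s t Ht) as [[Hu Hv] [Ha Hb]].
    split; [split|split; [exact Hb | now apply continuity_2d_pt_opp]].
    - now rewrite Ropp_involutive.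
    - intros eps; destruct (Hu eps) as [d Hd]; exists d; intros p' q' Hp' Hq'.
      eapply Rle_trans; [|exact (Hd p' q' Hp' Hq')].
      rewrite <- Rabs_Ropp; apply Req_le, f_equal; ring. }
  destruct (continuous_second_derivative u v a b Hcr) as [A HA].
  destruct (continuous_second_derivative _ _ _ _ Hcr') as [B HB].
  assert (Hd : forall s t, 0 < t ->
    fst (C_derive (fun w => w * C_derive g w)%C (s, t)) = a s t + s * A s t - t * B s t /\
    snd (C_derive (fun w => w * C_derive g w)%C (s, t)) = s * B s t + b s t + t * A s t).
  { intros s t Ht.
    (* The complex derivative of w g' is its partial derivative in the abscissa, computed by the
       product rule. *)
    destruct (analytic_cauchy_riemann _ s t HG Ht) as [H1 H2].
    apply differentiable_pt_lim_unique in H1; destruct H1 as [H1 _].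
    apply differentiable_pt_lim_unique in H2; destruct H2 as [H2 _].
    destruct (HA s t Ht) as [HAd _]; destruct (HB s t Ht) as [HBd _].
    rewrite <- H1, <- H2; split; apply is_derive_unique; simpl.
    - change (is_derive (fun x => x * a x t - t * b x t) s (a s t + s * A s t - t * B s t)).
      auto_derive; [repeat split; eexists; eassumption|].
      replace (Derive (fun x => a x t) s) with (A s t) by (symmetry; now apply is_derive_unique).
      replace (Derive (fun x => b x t) s) with (B s t) by (symmetry; now apply is_derive_unique).
      ring.
    - change (is_derive (fun x => x * b x t + t * a x t) s (s * B s t + b s t + t * A s t)).
      auto_derive; [repeat split; eexists; eassumption|].
      replace (Derive (fun x => a x t) s) with (A s t) by (symmetry; now apply is_derive_unique).
      replace (Derive (fun x => b x t) s) with (B s t) by (symmetry; now apply is_derive_unique).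
      ring. }
  destruct (HA p q Hq) as [_ HAc]; destruct (HB p q Hq) as [_ HBc].
  destruct (Hcr p q Hq) as [_ [Ha Hb]].
  split.
  - apply continuity_2d_pt_ext_loc with (fun s t => a s t + s * A s t - t * B s t).
    + exists (mkposreal _ Hq); simpl; intros s t _ Ht; apply Rabs_lt_between in Ht.
      symmetry; apply Hd; lra.
    + apply continuity_2d_pt_minus; [apply continuity_2d_pt_plus; [exact Ha|]|];
        apply continuity_2d_pt_mult; auto using continuity_2d_pt_id1, continuity_2d_pt_id2.
  - apply continuity_2d_pt_ext_loc with (fun s t => s * B s t + b s t + t * A s t).
    + exists (mkposreal _ Hq); simpl; intros s t _ Ht; apply Rabs_lt_between in Ht.
      symmetry; apply Hd; lra.
    + apply continuity_2d_pt_plus; [apply continuity_2d_pt_plus; [|exact Hb]|];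
        apply continuity_2d_pt_mult; auto using continuity_2d_pt_id1, continuity_2d_pt_id2.
Qed.

(** * Strong continuity of the dilations *)

Lemma exp_dilation (s : R) (w : C) :
  (RtoC (exp s) * w)%C = (exp s * Re w, exp s * Im w).
Proof. destruct w; unfold Cmult; simpl; f_equal; ring. Qed.

Lemma upper_half_plane_dilation (s : R) (w : C) :
  upper_half_plane w -> upper_half_plane (RtoC (exp s) * w)%C.
Proof.
  unfold upper_half_plane; rewrite exp_dilation; simpl; intros Hw.
  apply Rmult_lt_0_compat; [apply exp_pos | exact Hw].
Qed.

Lemma Cmod_RtoC_mult (r : R) (w : C) : 0 <= r -> Cmod (RtoC r * w)%C = r * Cmod w.
Proof. intros Hr; now rewrite Cmod_mult, Cmod_R, Rabs_pos_eq. Qed.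

Lemma bloch_weight_pos (f : C -> C) (w : C) : upper_half_plane w -> 0 <= bloch_weight f w.
Proof. intros Hw; apply Rmult_le_pos; [now apply Rlt_le | apply Cmod_ge_0]. Qed.

(** The factor e^s from the chain rule is exactly the one by which Im w is scaled; this is the
    dilation invariance of the Bloch seminorm. *)
Lemma bloch_weight_dilation (f : C -> C) (s : R) (w : C) :
  Im w * Cmod (RtoC (exp s) * C_derive f (RtoC (exp s) * w))%C =
  bloch_weight f (RtoC (exp s) * w)%C.
Proof.
  unfold bloch_weight; rewrite Cmod_RtoC_mult by apply Rlt_le, exp_pos.
  replace (Im (RtoC (exp s) * w)%C) with (exp s * Im w) by (now rewrite exp_dilation).
  ring.
Qed.

(** Near the real line and near infinity both terms are small, by the little Bloch condition at w
    and at e^s w. On the remaining compact set, the quantity is the increment of Im(z) f'(z) from w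
    to e^s w, controlled by uniform continuity. *)
Lemma dilation_strongly_continuous (f : C -> C) (eps : R) :
  little_bloch f ->
  (forall p q, 0 < q -> continuity_2d_pt (fun p q => fst (C_derive f (p, q))) p q /\
    continuity_2d_pt (fun p q => snd (C_derive f (p, q))) p q) ->
  0 < eps ->
  exists delta : posreal, forall s w, 0 <= s < delta -> upper_half_plane w ->
    Im w * Cmod (RtoC (exp s) * C_derive f (RtoC (exp s) * w) - C_derive f w)%C <= eps.
Proof.
  intros [_ Hl] Hc Heps.
  assert (He : 0 < eps / 2) by lra.
  destruct (Hl (mkposreal _ He)) as [D HD]; simpl in HD.
  pose proof (cond_pos D) as HDp; pose proof (Rinv_0_lt_compat _ HDp) as HDi.
  (* Since e^s <= 3 for s < 1, this rectangle contains e^s w as well as w when |w| <= 1 / D and Im w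
     >= D / 3. *)
  assert (Hc1 : forall p q, - (3 * / D) <= p <= 3 * / D -> D / 3 <= q <= 3 * / D ->
    continuity_2d_pt (fun p q => q * fst (C_derive f (p, q))) p q).
  { intros p q _ Hq; apply continuity_2d_pt_mult; [apply continuity_2d_pt_id2|].
    apply Hc; lra. }
  assert (Hc2 : forall p q, - (3 * / D) <= p <= 3 * / D -> D / 3 <= q <= 3 * / D ->
    continuity_2d_pt (fun p q => q * snd (C_derive f (p, q))) p q).
  { intros p q _ Hq; apply continuity_2d_pt_mult; [apply continuity_2d_pt_id2|].
    apply Hc; lra. }
  destruct (uniform_continuity_2d _ _ _ _ _ Hc1 (mkposreal _ He)) as [d1 Hd1].
  destruct (uniform_continuity_2d _ _ _ _ _ Hc2 (mkposreal _ He)) as [d2 Hd2].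
  cbn [pos] in Hd1, Hd2.
  set (d := Rmin d1 d2).
  assert (Hdp : 0 < d) by (apply Rmin_glb_lt; apply cond_pos).
  assert (Hdl : d <= d1 /\ d <= d2) by (split; [apply Rmin_l | apply Rmin_r]).
  assert (HdD : 0 < d * D) by (now apply Rmult_lt_0_compat).
  (* Below this logarithm e^s - 1 < d D, so points with |w| <= 1 / D move by less than [d]. *)
  assert (Hln : 0 < ln (1 + d * D)) by (rewrite <- ln_1; apply ln_increasing; lra).
  assert (Hdel : 0 < Rmin 1 (ln (1 + d * D))) by (apply Rmin_glb_lt; lra).
  exists (mkposreal _ Hdel); simpl; intros s w Hs Hw.
  pose proof (Rmin_l 1 (ln (1 + d * D))); pose proof (Rmin_r 1 (ln (1 + d * D))).
  assert (Hs1 : 1 <= exp s) by (pose proof (exp_ineq1_le s); lra).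
  assert (Hs3 : exp s <= 3) by (pose proof exp_le_3; pose proof (exp_increasing s 1 ltac:(lra)); lra).
  assert (Hsd : exp s - 1 < d * D).
  { assert (exp s < 1 + d * D); [|lra].
    rewrite <- (exp_ln (1 + d * D)) by lra; apply exp_increasing; lra. }
  (* The threshold D / 3 rather than D keeps Im(e^s w) below D. At infinity no margin is required,
     as e^s >= 1. *)
  destruct (Rlt_le_dec (Im w) (D / 3)) as [Hi|Hi];
    [|destruct (Rlt_le_dec (/ D) (Cmod w)) as [Hm|Hm]].
  - pose proof (HD w Hw ltac:(left; lra)) as H1.
    assert (Hi' : Im (RtoC (exp s) * w)%C < D).
    { rewrite exp_dilation; simpl; unfold upper_half_plane in Hw; nra. }
    pose proof (HD _ (upper_half_plane_dilation s w Hw) (or_introl Hi')) as H2.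
    rewrite <- bloch_weight_dilation in H2; unfold bloch_weight in H1.
    eapply Rle_trans;
      [apply Rmult_le_compat_l; [apply Rlt_le, Hw | apply Cmod_triangle]|].
    rewrite Cmod_opp; lra.
  - pose proof (HD w Hw ltac:(right; lra)) as H1.
    assert (Hm' : / D < Cmod (RtoC (exp s) * w)%C).
    { rewrite Cmod_RtoC_mult by lra; pose proof (Cmod_ge_0 w); nra. }
    pose proof (HD _ (upper_half_plane_dilation s w Hw) (or_intror Hm')) as H2.
    rewrite <- bloch_weight_dilation in H2; unfold bloch_weight in H1.
    eapply Rle_trans;
      [apply Rmult_le_compat_l; [apply Rlt_le, Hw | apply Cmod_triangle]|].
    rewrite Cmod_opp; lra.
  - rewrite <- Cmod_RtoC_mult by (apply Rlt_le, Hw).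
    eapply Rle_trans; [apply Cmod_le_Rabs|].
    destruct w as [p q]; unfold upper_half_plane in Hw; simpl in Hw, Hi.
    pose proof (Rle_trans _ _ _ (Rabs_fst_le_Cmod (p, q)) Hm) as Hp.
    pose proof (Rle_trans _ _ _ (Rabs_snd_le_Cmod (p, q)) Hm) as Hq.
    simpl in Hp, Hq.
    assert (Hpd : Rabs (exp s * p - p) < d).
    { replace (exp s * p - p) with ((exp s - 1) * p) by ring.
      rewrite Rabs_mult, (Rabs_pos_eq (exp s - 1)) by lra.
      apply Rle_lt_trans with ((exp s - 1) * / D);
        [apply Rmult_le_compat_l; lra|].
      apply Rmult_lt_reg_r with D; [exact HDp|].
      rewrite Rmult_assoc, Rinv_l by lra; lra. }
    assert (Hqd : Rabs (exp s * q - q) < d).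
    { replace (exp s * q - q) with ((exp s - 1) * q) by ring.
      rewrite Rabs_mult, (Rabs_pos_eq (exp s - 1)) by lra.
      apply Rle_lt_trans with ((exp s - 1) * / D);
        [apply Rmult_le_compat_l; lra|].
      apply Rmult_lt_reg_r with D; [exact HDp|].
      rewrite Rmult_assoc, Rinv_l by lra; lra. }
    apply Rabs_le_between in Hp; apply Rabs_le_between in Hq.
    assert (Hr1 : - (3 * / D) <= p <= 3 * / D) by lra.
    assert (Hr2 : D / 3 <= q <= 3 * / D) by lra.
    assert (Hr3 : - (3 * / D) <= exp s * p <= 3 * / D) by nra.
    assert (Hr4 : D / 3 <= exp s * q <= 3 * / D) by nra.
    specialize (Hd1 _ _ _ _ Hr1 Hr2 Hr3 Hr4 ltac:(lra) ltac:(lra)).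
    specialize (Hd2 _ _ _ _ Hr1 Hr2 Hr3 Hr4 ltac:(lra) ltac:(lra)).
    cbv beta in Hd1, Hd2; rewrite (exp_dilation s (p, q)); unfold Re, Im; cbn [fst snd].
    set (X := C_derive f (exp s * p, exp s * q)) in *.
    set (Y := C_derive f (p, q)) in *.
    replace (fst (RtoC q * (RtoC (exp s) * X - Y))%C) with (exp s * q * fst X - q * fst Y)
      by (simpl; ring).
    replace (snd (RtoC q * (RtoC (exp s) * X - Y))%C) with (exp s * q * snd X - q * snd Y)
      by (simpl; ring).
    lra.
Qed.

(** * The generator *)

Lemma bloch_norm_lt_elim (h : C -> C) (eps : R) :
  Rbar_lt (bloch_norm h) eps ->
  Cmod (h Ci) < eps /\ forall w, upper_half_plane w -> bloch_weight h w <= eps.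
Proof.
  unfold bloch_norm; intros H.
  assert (Hs : is_lub_Rbar (fun x => exists w, upper_half_plane w /\ x = bloch_weight h w)
    (bloch_seminorm h)) by apply Lub_Rbar_correct.
  destruct Hs as [Hub _].
  assert (Hw : forall w, upper_half_plane w -> Rbar_le (bloch_weight h w) (bloch_seminorm h))
    by (intros w Hw; apply Hub; exists w; auto).
  (* The weight at i shows that the supremum is nonnegative, which excludes [m_infty] and lets the
     norm bound |h(i)|. *)
  pose proof (bloch_weight_pos h Ci Im_Ci_pos) as H0.
  pose proof (Cmod_ge_0 (h Ci)).
  pose proof (Hw _ Im_Ci_pos) as Hi.
  destruct (bloch_seminorm h) as [r| |]; simpl in *; try easy.
  split; [lra|]; intros w Hw'; specialize (Hw w Hw'); lra.
Qed.

Lemma bloch_norm_lt_intro (h : C -> C) (M eps : R) :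
  (forall w, upper_half_plane w -> bloch_weight h w <= M) ->
  Cmod (h Ci) + M < eps -> Rbar_lt (bloch_norm h) eps.
Proof.
  intros Hw HM; unfold bloch_norm.
  assert (Hs : Rbar_le (bloch_seminorm h) M).
  { apply (Lub_Rbar_correct (fun x => exists w, upper_half_plane w /\ x = bloch_weight h w)).
    intros x [w [H ->]]; now apply Hw. }
  destruct (bloch_seminorm h) as [r| |]; simpl in *; try easy; lra.
Qed.

Lemma has_velocity_segment (z w : C) (s : R) :
  has_velocity (fun s => z + RtoC s * (w - z))%C s (w - z)%C.
Proof. split; simpl; auto_derive; trivial; ring. Qed.

Lemma has_velocity_dilation (w : C) (s : R) :
  has_velocity (fun s => RtoC (exp s) * w)%C s (RtoC (exp s) * w)%C.
Proof. split; simpl; auto_derive; trivial; ring. Qed.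

(** On the segment from i to w the imaginary part is at least min(1, Im w), so |h'| is at most M
    divided by it. With the value at i, this bounds point values by the Bloch norm. *)
Lemma Cmod_increment_le_bloch (h : C -> C) (w : C) (M : R) :
  analytic_on_U h -> upper_half_plane w ->
  (forall z, upper_half_plane z -> bloch_weight h z <= M) ->
  Cmod (h w - h Ci)%C <= 2 * (M / Rmin 1 (Im w) * Cmod (w - Ci)%C).
Proof.
  intros Hh Hw HM; unfold upper_half_plane in Hw.
  pose proof (Rmin_l 1 (Im w)) as H1; pose proof (Rmin_r 1 (Im w)) as H2.
  assert (Hm : 0 < Rmin 1 (Im w)) by (apply Rmin_glb_lt; lra).
  set (m := Rmin 1 (Im w)) in *.
  set (phi := fun s => (Ci + RtoC s * (w - Ci))%C).
  assert (HI : forall s, 0 <= s <= 1 -> m <= Im (phi s)).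
  { intros s Hs; replace (Im (phi s)) with (1 + s * (Im w - 1)) by (unfold phi, Im; simpl; ring).
    nra. }
  replace w with (phi 1) at 1 by (unfold phi; ring).
  replace Ci with (phi 0) at 1 by (unfold phi; ring).
  replace (2 * (M / m * Cmod (w - Ci)%C)) with (2 * (M / m * Cmod (w - Ci)%C) * (1 - 0)) by ring.
  apply (Cmod_increment_le (fun s => h (phi s)) (fun s => C_derive h (phi s) * (w - Ci))%C);
    [lra | |]; intros s Hs; specialize (HI s Hs);
    assert (HU : upper_half_plane (phi s)) by (unfold upper_half_plane; lra).
  - apply has_velocity_comp; [now apply is_derive_C_derive | apply has_velocity_segment].
  - rewrite Cmod_mult; apply Rmult_le_compat_r; [apply Cmod_ge_0|].
    specialize (HM _ HU); unfold bloch_weight in HM.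
    apply Rmult_le_reg_l with m; [exact Hm|].
    replace (m * (M / m)) with M by (field; lra).
    pose proof (Cmod_ge_0 (C_derive h (phi s))); nra.
Qed.

(* Coquelicot gives [C] two uniform structures with the same neighbourhoods: that of
   [C_NormedModule] and that of [C_AbsRing]. *)
Lemma is_derive_C_AbsRing (f : C -> C) (w d : C) :
  is_derive (K := C_AbsRing) (V := C_NormedModule) f w d <->
  is_derive (K := C_AbsRing) (V := AbsRing_NormedModule C_AbsRing) f w d.
Proof. split; (intros [_ H]; split; [apply is_linear_scal_l | exact H]). Qed.

Definition quotient_error (g k : C -> C) (t : R) (w : C) : C :=
  ((dilation t g w - g w) / RtoC t - k w)%C.

Lemma is_derive_quotient_error (g k : C -> C) (t : R) (w : C) :
  analytic_on_U g -> analytic_on_U k -> upper_half_plane w ->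
  is_derive (K := C_AbsRing) (V := C_NormedModule) (quotient_error g k t) w
    ((RtoC (exp t) * C_derive g (RtoC (exp t) * w) - C_derive g w) / RtoC t - C_derive k w)%C.
Proof.
  intros Hg Hk Hw.
  assert (Hs : is_derive (K := C_AbsRing) (V := C_NormedModule)
    (dilation t g) w (RtoC (exp t) * C_derive g (RtoC (exp t) * w))%C).
  { apply (is_derive_comp (K := C_AbsRing) (V := C_NormedModule) g
      (fun z => (RtoC (exp t) * z)%C)).
    - now apply is_derive_C_derive; [|apply upper_half_plane_dilation].
    - apply (is_derive_ext (K := C_AbsRing) (V := AbsRing_NormedModule C_AbsRing)
        (fun z => scal z (RtoC (exp t)))); [intros z; apply Cmult_comm|].
      pose proof (is_derive_scal_l (K := C_AbsRing) (V := AbsRing_NormedModule C_AbsRing)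
        (fun z => z) w one (RtoC (exp t)) (is_derive_id (K := C_AbsRing) w)) as H.
      change (scal one (RtoC (exp t))) with (1 * RtoC (exp t))%C in H.
      now rewrite Cmult_1_l in H. }
  apply (is_derive_minus (K := C_AbsRing) (V := C_NormedModule));
    [|now apply is_derive_C_derive].
  (* Division by t is multiplication of a scalar function by the fixed vector 1 / t, hence the
     passage to the structure of [C_AbsRing]. *)
  apply (is_derive_scal_l (K := C_AbsRing) (V := C_NormedModule)
    (fun w => dilation t g w - g w)%C _ _ (/ RtoC t)%C), is_derive_C_AbsRing.
  apply (is_derive_minus (K := C_AbsRing) (V := C_NormedModule)); [exact Hs|].
  now apply is_derive_C_derive.
Qed.

(** The curve e^s w has velocity w at s = 0, so the difference quotients of g along it tend to w
    g'(w). *)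
Lemma quotient_error_pointwise (g k : C -> C) (w : C) (eps : R) :
  analytic_on_U g -> upper_half_plane w -> 0 < eps ->
  exists delta : posreal, forall t, 0 < t < delta ->
    Cmod (quotient_error g k t w - (w * C_derive g w - k w))%C < eps.
Proof.
  intros Hg Hw Heps.
  assert (Hv : has_velocity (fun s => g (RtoC (exp s) * w)%C) 0 (w * C_derive g w)%C).
  { replace (w * C_derive g w)%C with
      (C_derive g (RtoC (exp 0) * w) * (RtoC (exp 0) * w))%C
      by (rewrite exp_0, Cmult_1_l; ring).
    apply (has_velocity_comp g (fun s => RtoC (exp s) * w)%C).
    - now apply is_derive_C_derive; [|apply upper_half_plane_dilation].
    - apply has_velocity_dilation. }
  destruct (has_velocity_quotient _ _ eps Hv Heps) as [delta Hd].
  exists delta; intros t Ht; specialize (Hd t Ht); cbv beta in Hd.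
  rewrite exp_0, Cmult_1_l in Hd.
  replace (quotient_error g k t w - (w * C_derive g w - k w))%C with
    ((g (RtoC (exp t) * w) - g w) / RtoC t - w * C_derive g w)%C; [exact Hd|].
  unfold quotient_error, dilation; ring.
Qed.

(** At w the error of the difference quotient tends to 0, by convergence in norm, and also to w
    g'(w) - k(w), by differentiation along the orbit. *)
Lemma generator_graph_eq (g k : C -> C) (w : C) :
  generator_graph dilation g k -> upper_half_plane w -> k w = (w * C_derive g w)%C.
Proof.
  intros [[[Hg _] _] [[[Hk _] _] Hlim]] Hw.
  (* Evaluation at w is bounded by K times the Bloch norm: 1 accounts for the value at i, the rest
     for the increment from i to w. The tolerance [eps / (2 * K)] below thus yields [eps / 2]. *)
  set (K := 1 + 2 * (/ Rmin 1 (Im w) * Cmod (w - Ci)%C)).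
  assert (HK : 1 <= K).
  { assert (0 < Rmin 1 (Im w)) as Hm by (apply Rmin_glb_lt; [lra | exact Hw]).
    apply Rinv_0_lt_compat in Hm; pose proof (Cmod_ge_0 (w - Ci)%C); unfold K; nra. }
  assert (Hsmall : forall eps, 0 < eps -> Cmod (w * C_derive g w - k w)%C <= eps).
  { intros eps Heps.
    assert (He : 0 < eps / (2 * K)) by (apply Rdiv_lt_0_compat; lra).
    destruct (Hlim (mkposreal _ He)) as [d1 Hd1].
    destruct (quotient_error_pointwise g k w (eps / 2) Hg Hw ltac:(lra)) as [d2 Hd2].
    set (t := Rmin d1 d2 / 2).
    assert (Hd : 0 < Rmin d1 d2) by (apply Rmin_glb_lt; apply cond_pos).
    pose proof (Rmin_l d1 d2); pose proof (Rmin_r d1 d2).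
    assert (Ht : 0 < t < d1 /\ t < d2) by (unfold t; lra).
    assert (Hb : ball 0 d1 t).
    { change (Rabs (t - 0) < d1); rewrite Rminus_0_r, Rabs_pos_eq; lra. }
    specialize (Hd1 t Hb ltac:(lra)); simpl in Hd1.
    apply (bloch_norm_lt_elim (quotient_error g k t)) in Hd1; destruct Hd1 as [Hi Hwt].
    specialize (Hd2 t ltac:(lra)).
    assert (Ha : analytic_on_U (quotient_error g k t))
      by (intros z Hz; eexists; now apply is_derive_quotient_error).
    pose proof (Cmod_increment_le_bloch _ w _ Ha Hw Hwt) as Hinc.
    set (q := quotient_error g k t) in *.
    replace (w * C_derive g w - k w)%C with
      (- (q w - (w * C_derive g w - k w)) + ((q w - q Ci) + q Ci))%C by ring.
    eapply Rle_trans; [apply Cmod_triangle|]; rewrite Cmod_opp.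
    pose proof (Cmod_triangle (q w - q Ci) (q Ci)) as Htr.
    replace (2 * (eps / (2 * K) / Rmin 1 (Im w) * Cmod (w - Ci)%C))
      with (eps / (2 * K) * (K - 1)) in Hinc by (unfold K, Rdiv; ring).
    assert (E : eps / (2 * K) * (K - 1) + eps / (2 * K) = eps / 2) by (field; lra).
    lra. }
  replace (k w) with (w * C_derive g w - (w * C_derive g w - k w))%C by ring.
  replace (w * C_derive g w - k w)%C with (RtoC 0); [ring|].
  symmetry; apply Cmod_eq_0.
  apply Rle_antisym; [|apply Cmod_ge_0].
  apply le_epsilon; intros eps Heps; rewrite Rplus_0_l; now apply Hsmall.
Qed.

(* With [G = w g'], multiplying the derivative of the difference quotient's error by [w]
   gives [(G (e^t w) - G w) / t - w G'(w)], the mean of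
   [e^s w G'(e^s w) - w G'(w)] over [0 <= s <= t]. *)
Lemma bloch_weight_quotient_error (g : C -> C) (w : C) (t M : R) :
  analytic_on_U g -> analytic_on_U (fun z => z * C_derive g z)%C ->
  upper_half_plane w -> 0 < t ->
  (forall s, 0 <= s <= t -> Im w *
    Cmod (RtoC (exp s) * C_derive (fun z => z * C_derive g z)%C (RtoC (exp s) * w) -
          C_derive (fun z => z * C_derive g z)%C w)%C <= M) ->
  bloch_weight (quotient_error g (fun z => z * C_derive g z)%C t) w <= 2 * M.
Proof.
  intros Hg HG Hw Ht HM; unfold bloch_weight.
  rewrite (is_C_derive_unique _ _ _ (is_derive_quotient_error _ _ t w Hg HG Hw)).
  set (G := fun z => (z * C_derive g z)%C) in *.
  set (d := (_ / RtoC t - C_derive G w)%C).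
  assert (Hw0 : w <> RtoC 0).
  { intros E; unfold upper_half_plane in Hw; rewrite E in Hw; simpl in Hw; lra. }
  assert (Ht0 : RtoC t <> RtoC 0) by (intros E; apply RtoC_inj in E; lra).
  pose proof (Cmod_gt_0 w) as [Hm _]; specialize (Hm Hw0).
  (* Subtracting s w G'(w), written as a segment from 0, makes the velocity of [phi] equal to w
     times the difference bounded by the hypothesis on [M]. *)
  set (phi := fun s => (G (RtoC (exp s) * w) - (RtoC 0 + RtoC s * (w * C_derive G w - RtoC 0)))%C).
  assert (Hphi : (phi t - phi 0)%C = (RtoC t * w * d)%C).
  { unfold phi, d, G; rewrite exp_0, Cmult_1_l; field; exact Ht0. }
  assert (Hinc : Cmod (phi t - phi 0)%C <= 2 * (Cmod w * (M / Im w)) * (t - 0)).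
  { apply (Cmod_increment_le phi (fun s => C_derive G (RtoC (exp s) * w) * (RtoC (exp s) * w)
      - (w * C_derive G w - RtoC 0))%C); [lra | |]; intros s Hs.
    - assert (HU : upper_half_plane (RtoC (exp s) * w)%C) by now apply upper_half_plane_dilation.
      destruct (has_velocity_comp _ _ s _ _ (is_derive_C_derive _ _ HG HU)
        (has_velocity_dilation w s)) as [H1 H2].
      destruct (has_velocity_segment (RtoC 0) (w * C_derive G w) s) as [H3 H4].
      split; apply (is_derive_minus (K := R_AbsRing) (V := R_NormedModule)); assumption.
    - replace (C_derive G (RtoC (exp s) * w) * (RtoC (exp s) * w)
        - (w * C_derive G w - RtoC 0))%C with
        (w * (RtoC (exp s) * C_derive G (RtoC (exp s) * w) - C_derive G w))%C by ring.
      rewrite Cmod_mult; apply Rmult_le_compat_l; [apply Cmod_ge_0|].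
      apply Rmult_le_reg_l with (Im w); [exact Hw|].
      replace (Im w * (M / Im w)) with M
        by (unfold upper_half_plane in Hw; field; lra).
      now apply HM. }
  rewrite Hphi, !Cmod_mult, Cmod_R, (Rabs_pos_eq t) in Hinc by lra.
  apply Rmult_le_reg_l with (t * Cmod w / Im w);
    [apply Rdiv_lt_0_compat; [now apply Rmult_lt_0_compat | exact Hw]|].
  unfold upper_half_plane in Hw.
  replace (t * Cmod w / Im w * (Im w * Cmod d)) with (t * Cmod w * Cmod d) by (field; lra).
  replace (t * Cmod w / Im w * (2 * M)) with (2 * (Cmod w * (M / Im w)) * (t - 0))
    by (field; lra).
  exact Hinc.
Qed.

Lemma generator_graph_intro (g : C -> C) :
  little_bloch_i g -> little_bloch_i (fun w => w * C_derive g w)%C ->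
  generator_graph dilation g (fun w => w * C_derive g w)%C.
Proof.
  intros Hg HG; split; [exact Hg|split; [exact HG|]]; intros eps.
  destruct Hg as [[Hg _] _]; destruct HG as [HGl _]; pose proof (proj1 HGl) as HG.
  pose proof (cond_pos eps) as Heps.
  (* The seminorm of the error is then at most 2 (eps / 8) = eps / 4, and its value at i is below
     eps / 2. *)
  destruct (dilation_strongly_continuous _ (eps / 8) HGl
    (fun p q => continuity_2d_pt_second_derivative g p q Hg HG) ltac:(lra)) as [d1 Hd1].
  destruct (quotient_error_pointwise g (fun w => w * C_derive g w)%C Ci (eps / 2)
    Hg Im_Ci_pos ltac:(lra)) as [d2 Hd2].
  exists (mkposreal _ (Rmin_stable_in_posreal d1 d2)); intros t Hb Ht.
  change (Rabs (t - 0) < Rmin d1 d2) in Hb.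
  rewrite Rminus_0_r, Rabs_pos_eq in Hb by lra.
  pose proof (Rmin_l d1 d2); pose proof (Rmin_r d1 d2).
  apply (bloch_norm_lt_intro (quotient_error g (fun w => w * C_derive g w)%C t) (2 * (eps / 8))).
  - intros w Hw; apply bloch_weight_quotient_error; try assumption.
    intros s Hs; apply Hd1; [lra | exact Hw].
  - specialize (Hd2 t ltac:(lra)); cbv beta in Hd2.
    (* With k = w g' the pointwise limit of the error is 0, inserted here in the form that [Hd2]
       subtracts. *)
    rewrite <- (Cplus_0_r (quotient_error _ _ _ _)) at 1.
    replace (RtoC 0) with (- (Ci * C_derive g Ci - Ci * C_derive g Ci))%C by ring.
    unfold Cminus in Hd2 at 1; lra.
Qed.

Theorem theorem3p2 :
  (forall g k : C -> C, generator_graph dilation g k ->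
     forall w : C, upper_half_plane w -> k w = (w * C_derive g w)%C) /\
  (forall g : C -> C,
     generator_domain dilation g <->
     little_bloch_i g /\ little_bloch_i (fun w => (w * C_derive g w)%C)).
Proof.
  split; [intros g k H w Hw; now apply generator_graph_eq|].
  intros g; split.
  - intros [k H]; split; [apply H|].
    apply (little_bloch_i_ext k); [|apply H].
    intros w Hw; now apply generator_graph_eq.
  - intros [Hg HG]; eexists; now apply generator_graph_intro.
Qed.
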